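(* Let $V$ be a nonzero finite-dimensional $\mathbb{C}$-vector space and let $\mathcal{A}$ be an essential reflection arrangement in $V$. For each $H \in \mathcal{A}$ let $\alpha_H \in V^*$ be a linear form with kernel $H$. Let $\mathbb{C}\mathcal{A}$ be the vector space with basis $(v_H)_{H \in \mathcal{A}}$ and let $\Phi : \mathbb{C}\mathcal{A} \to S^2 V^*$ be the linear map defined by $\Phi(v_H) = \alpha_H^2$. Then $\Phi$ is surjective if and only if $\mathcal{A}$ is irreducible.
   Context: A hyperplane arrangement in $V$ is a finite collection of linear hyperplanes of $V$; it is essential if the intersection of its members is $\{0\}$. A reflection arrangement is one of the form $\{\mathrm{Ker}(s-1) : s \text{ a reflection of } W\}$, where $W \subset \mathrm{GL}(V)$ is a finite group generated by (pseudo-)reflections (finite-order elements $s$ such that $\mathrm{Ker}(s-1)$ is a hyperplane). For arrangements $\mathcal{A}_1,\mathcal{A}_2$ in $V_1,V_2$, the arrangement $\mathcal{A}_1 \times \mathcal{A}_2$ in $V_1 \oplus V_2$ is $\{H \oplus V_2 : H \in \mathcal{A}_1\} \cup \{V_1 \oplus H : H \in \mathcal{A}_2\}$. Two arrangements are isomorphic if a linear isomorphism of the ambient spaces takes one to the other. An essential arrangement is irreducible if it is not isomorphic to a product $\mathcal{A}_1 \times \mathcal{A}_2$ with $V_1$ and $V_2$ both nonzero. $S^2V^*$ is the space of quadratic forms on $V$. *)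

(* Defs.v *)
From HB Require Import structures.
From mathcomp Require Export all_boot all_order all_algebra.
From mathcomp Require Export finmap.
From mathcomp Require Export boolp classical_sets functions cardinality reals.
From mathcomp Require Export complex.
From mathcomp Require Import ring.

Set Implicit Arguments.
Unset Strict Implicit.
Unset Printing Implicit Defensive.

Import GRing.Theory.

Local Open Scope classical_set_scope.
Local Open Scope fset_scope.
Local Open Scope ring_scope.

Section QuadraticForms.
Variables (F : fieldType) (V : vectType F).

(* The polarization of q, that is the bilinear form (twice the usual one in
   characteristic not 2) associated with a quadratic form q. *)
Definition polar (q : V -> F^o) (u v : V) : F^o := q (u + v) - q u - q v.

Definition is_quadratic (q : V -> F^o) : Prop :=
  [/\ forall (a : F) v, q (a *: v) = a ^+ 2 * q v,
      forall v, scalar (polar q ^~ v)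
    & forall u, scalar (polar q u)].

Definition quadratic_pred : {pred V -> F^o} := fun q => `[< is_quadratic q >].

Fact quadratic_submod_closed : submod_closed quadratic_pred.
Proof.
split.
  apply/asboolP; split => [a v|v a x y|v a x y].
  - by rewrite [0 (a *: v)]/(0 : F) [0 v]/(0 : F) mulr0.
  - by rewrite /polar /= !subr0 mulr0 addr0.
  - by rewrite /polar /= !subr0 mulr0 addr0.
move=> a p q /asboolP[hp lp rp] /asboolP[hq lq rq]; apply/asboolP.
have polarE u v : polar (a *: p + q) u v = a * polar p u v + polar q u v.
  have fE w : (a *: p + q) w = (a * (p w : F) + (q w : F) : F) by [].
  rewrite /polar !fE; set p1 := p _; set p2 := p u; set p3 := p v.
  by set q1 := q _; set q2 := q u; set q3 := q v; ring.
split => [b v|v b x y|v b x y].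
- rewrite -![(a *: p + q) _]/(a * p _ + q _) hp hq; ring.
- rewrite !polarE lp lq; ring.
- rewrite !polarE rp rq; ring.
Qed.

HB.instance Definition _ :=
  GRing.isSubmodClosed.Build F (V -> F^o) quadratic_pred
    quadratic_submod_closed.

(* S^2 V^*, as a vector space of functions on V. *)
Record quadform : Type := QuadForm {
  quadform_fun :> V -> F^o;
  quadformP : quadform_fun \in quadratic_pred
}.

HB.instance Definition _ := [isSub for quadform_fun].
HB.instance Definition _ := [Choice of quadform by <:].
HB.instance Definition _ := [SubChoice_isSubLmodule of quadform by <:].

Fact sqform_subproof (alpha : 'Hom(V, F^o)) :
  (fun v => alpha v ^+ 2 : F^o) \in quadratic_pred.
Proof.
have polarE u v : polar (fun v => alpha v ^+ 2 : F^o) u v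
                  = 2 * (alpha u * alpha v).
  have sqD (b c : F) : (b + c) ^+ 2 - b ^+ 2 - c ^+ 2 = 2 * (b * c) by ring.
  by rewrite /polar linearD; exact: sqD.
apply/asboolP; split => [a v|v a x y|v a x y].
- by rewrite /= linearZ exprMn.
- have e (b c d : F) :
    2 * ((a * b + c) * d) = a * (2 * (b * d)) + 2 * (c * d) by ring.
  by rewrite !polarE linearP; exact: e.
- have e (b c d : F) :
    2 * (d * (a * b + c)) = a * (2 * (d * b)) + 2 * (d * c) by ring.
  by rewrite !polarE linearP; exact: e.
Qed.

Definition sqform (alpha : 'Hom(V, F^o)) : quadform :=
  QuadForm (sqform_subproof alpha).

End QuadraticForms.

Section Arrangements.
Variable F : fieldType.

Section OneSpace.
Variable V : vectType F.
Implicit Types (H : {vspace V}) (s : 'End(V)) (A : {fset {vspace V}}).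

Definition hyperplane H : Prop := (\dim H).+1 = \dim {:V}.

Definition arrangement A : Prop := forall H, H \in A -> hyperplane H.

Definition essential A : Prop := (\bigcap_(H <- A) H = 0 :> {vspace V})%VS.

Definition reflection s : Prop :=
  (exists2 n, (0 < n)%N & iter n s =1 id) /\ hyperplane (lker (s - \1%VF)).

Definition GL_subgroup (G : set 'End(V)) : Prop :=
  [/\ forall g, G g -> lker g = 0%VS,
      G \1%VF,
      forall g h, G g -> G h -> G (g \o h)%VF
    & forall g, G g -> G (g^-1)%VF].

Definition finite_reflection_group (W : set 'End(V)) : Prop :=
  finite_set W /\
  exists2 S : set 'End(V),
    (forall s, S s -> reflection s) & W = smallest GL_subgroup S.

Definition reflection_arrangement A : Prop :=
  exists2 W : set 'End(V), finite_reflection_group W &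
    forall H, H \in A <->
      exists s, [/\ W s, reflection s & H = lker (s - \1%VF)].

End OneSpace.

Definition dsumv (V1 V2 : vectType F) (U1 : {vspace V1}) (U2 : {vspace V2}) :
    {vspace (V1 * V2)%type} :=
  (linfun fst @^-1: U1 :&: linfun snd @^-1: U2)%VS.

Lemma mem_dsumv (V1 V2 : vectType F) (U1 : {vspace V1}) (U2 : {vspace V2})
    (v : V1 * V2) :
  (v \in dsumv U1 U2) = (v.1 \in U1) && (v.2 \in U2).
Proof. by rewrite /dsumv memv_cap -!memv_preim !lfunE. Qed.

Definition arr_prod (V1 V2 : vectType F) (A1 : {fset {vspace V1}})
    (A2 : {fset {vspace V2}}) : {fset {vspace (V1 * V2)%type}} :=
  [fset dsumv H fullv | H in A1] `|` [fset dsumv fullv H | H in A2].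

Definition arr_isom (V V' : vectType F) (A : {fset {vspace V}})
    (A' : {fset {vspace V'}}) : Prop :=
  exists f : 'Hom(V, V'),
    bijective f /\ A' = [fset (f @: H)%VS | H in A].

(* Only meaningful for essential arrangements. *)
Definition irreducible_arr (V : vectType F) (A : {fset {vspace V}}) : Prop :=
  ~ exists (V1 V2 : vectType F) (A1 : {fset {vspace V1}})
      (A2 : {fset {vspace V2}}),
      [/\ (0 < \dim {:V1})%N /\ (0 < \dim {:V2})%N,
          arrangement A1 /\ arrangement A2
        & arr_isom A (arr_prod A1 A2)].

(* The basis vector v_H of the free vector space {ffun A -> F^o} on A. *)
Definition basis_vec (V : vectType F) (A : {fset {vspace V}}) (H : A) :
    {ffun A -> F^o} :=
  [ffun K => (K == H)%:R].

End Arrangements.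

(* Main.v *)
(* If A is a product, no combination of the squares alpha_H ^ 2 has a mixed term,
   so Phi is not surjective.

   Conversely, write the reflections of W as v - alpha_H(v) c. Two reflections
   (H, c), (K, d) are adjacent when alpha_K(c) <> 0, which is a symmetric
   relation because W is finite. If x and y are adjacent, the form alpha_y
   composed with the reflection of x is alpha_y - alpha_y(c_x) alpha_x and is
   proportional to some alpha_z; expanding its square puts alpha_x alpha_y in the
   image of Phi. The same holds for x and y joined by a chain, by induction on
   its length. So if the graph is connected all the products alpha_H alpha_K are
   in the image, and they span the quadratic forms since A is essential. If the
   graph is disconnected, the intersections of the hyperplanes of a component and
   of its complement are supplementary subspaces which split A as a product. *)
From HB Require Import structures.
From mathcomp Require Import ring.
Require Import Defs.

Set Implicit Arguments.
Unset Strict Implicit.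
Unset Printing Implicit Defensive.

Import GRing.Theory.

Local Open Scope classical_set_scope.
Local Open Scope fset_scope.
Local Open Scope ring_scope.

(** The family intersected by [smallest] has a member, the set of all invertible maps; with no
    member, the intersection would inherit no invertibility. *)
Lemma smallest_GL_subgroup (F : fieldType) (V : vectType F)
    (S : set 'End(V)) :
  (forall s, S s -> lker s = 0%VS) ->
  GL_subgroup (smallest (@GL_subgroup F V) S).
Proof.
move=> S0.
have GL0 : GL_subgroup [set g : 'End(V) | lker g = 0%VS].
  split => //=.
  - by apply/eqP/lker0P => u v; rewrite !id_lfunE.
  - move=> g h /eqP/lker0P gI /eqP/lker0P hI; apply/eqP/lker0P => u v.
    by rewrite !comp_lfunE => /gI/hI.
  - move=> g /eqP g0; apply/eqP/lker0P; exact: can_inj (lker0_lfunVK g0).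
split.
- by move=> g /(_ _ (conj GL0 S0)).
- by move=> G [[]].
- move=> g h Gg Gh G GG; have [[_ _ M _] _] := GG.
  by apply: M; [exact: Gg|exact: Gh].
- by move=> g Gg G GG; have [[_ _ _ I] _] := GG; apply: I; exact: Gg.
Qed.

(** * Finite linear groups in characteristic zero *)

Section FiniteLinearGroup.
Variables (F : fieldType) (charF0 : [pchar F] =i pred0).
Variables (V : vectType F) (W : set 'End(V)).
Hypotheses (W_fin : finite_set W) (W_grp : GL_subgroup W).

Lemma natf_neq0_pchar0 n : (0 < n)%N -> n%:R != 0 :> F.
Proof. by move: charF0 => /pcharf0P -> ; rewrite -lt0n. Qed.

Lemma finite_group_inj g : W g -> injective g.
Proof. by case: W_grp => W0 _ _ _ /W0 /eqP/lker0P. Qed.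

(** By pigeonhole, two of the first [|X| + 1] powers of [g] coincide, where [X] lists [W];
    injectivity cancels the smaller exponent. *)
Lemma finite_group_order g : W g -> exists2 n, (0 < n)%N & iter n g =1 id.
Proof.
move=> Wg; have [_ W1 WM _] := W_grp.
have /finite_fsetP[X WX] := W_fin.
pose pw n : 'End(V) := iter n (fun h => g \o h)%VF \1%VF.
have Wpw n : W (pw n) by elim: n => //= n IH; exact: WM.
have pwE n v : pw n v = iter n g v.
  by elim: n => [|n IH] /=; rewrite ?id_lfunE // comp_lfunE IH.
have : ~~ uniq [seq pw i | i <- iota 0 #|` X|.+1].
  apply/negP => Upw; have := uniq_leq_size (s2 := enum_fset X) Upw.
  rewrite size_map size_iota ltnn => h; suff: false by []; apply: h.
  by move=> _ /mapP[i _ ->]; have := Wpw i; rewrite WX.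
move=> /(uniqPn 0)[i [j []]]; rewrite size_map size_iota => ltij ltj.
rewrite !(nth_map 0%N) ?size_iota ?(ltn_trans ltij) //.
rewrite !nth_iota ?(ltn_trans ltij) // !add0n => /lfunP eqij.
exists (j - i)%N; first by rewrite subn_gt0.
move=> v; have iI : injective (iter i g).
  by elim: (i) => //= k IH u w /(finite_group_inj Wg) /IH.
by apply: iI; rewrite -iterD subnKC 1?ltnW // -!pwE -eqij.
Qed.

(* A unipotent element of square-zero type is trivial, since its n-th power is
   1 + n (g - 1). *)
Lemma finite_group_unipotent g :
  W g -> (forall v, g (g v - v) = g v - v) -> g =1 id.
Proof.
move=> Wg gN v; have [n n_gt0 gn] := finite_group_order Wg.
have itE k : iter k g v = v + k%:R *: (g v - v).
  elim: k => [|k IH]; first by rewrite scale0r addr0.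
  rewrite iterS IH linearD linearZ /= gN -[k.+1]add1n natrD scalerDl scale1r.
  by rewrite addrA subrKC.
have /eqP := gn v; rewrite itE /= -subr_eq0 addrC addKr scaler_eq0.
by rewrite (negPf (natf_neq0_pchar0 n_gt0)) subr_eq0 => /eqP.
Qed.

(* The average of v over {g in W | g = 1 mod U} is fixed by T and congruent to v
   mod U. *)
Lemma finite_group_coinvariants (T : set 'End(V)) (U : {vspace V}) :
    (T `<=` W)%classic -> (forall s v, T s -> s v - v \in U) ->
    (forall w, (forall s, T s -> s w = w) -> w = 0) ->
  U = fullv.
Proof.
move=> TW TU T0; have [_ W1 WM _] := W_grp.
have /finite_fsetP[X WX] := W_fin.
have inX g : (g \in X) <-> W g by rewrite WX.
pose G := [fset g in X | `[< forall v, (g : 'End(V)) v - v \in U >]].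
have inG g : (g \in G) <-> W g /\ forall v, g v - v \in U.
  rewrite !inE /=; split.
    by move=> /andP[/inX ? /asboolP ?].
  by move=> [? ?]; apply/andP; split; [exact/inX|exact/asboolP].
clearbody G.
apply/eqP; rewrite eqEsubv subvf; apply/subvP => v _.
pose w := \sum_(g <- G) g v.
have w0 : w = 0.
  apply: T0 => s Ts; have Ws := TW _ Ts.
  have sI : injective (fun g : 'End(V) => (s \o g)%VF).
    move=> g h /lfunP sgh; apply/lfunP => u.
    by have := sgh u; rewrite !comp_lfunE => /(finite_group_inj Ws).
  (* Left multiplication by [s] permutes [G], because [s] is itself trivial modulo [U]; hence [s]
     fixes [w]. *)
  have GE : [fset (s \o g)%VF | g in G] = G.
    apply/eqP; rewrite eqEfcard card_imfset //= leqnn andbT.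
    apply/fsubsetP => _ /imfsetP[g /= /inG[Wg gU] ->]; apply/inG; split.
      exact: WM.
    move=> u; rewrite comp_lfunE -[s _](subrK (g u)) -addrA.
    by rewrite memvD // TU.
  rewrite /w -[in RHS]GE big_imfset /=; last by move=> g h _ _; exact: sI.
  by rewrite linear_sum; apply: eq_bigr => g _; rewrite comp_lfunE.
have sumv : \sum_(g <- G) v = #|` G|%:R *: v.
  by rewrite big_const_seq count_predT iter_addr_0 scaler_nat.
have : w - #|` G|%:R *: v \in U.
  rewrite -sumv -sumrB big_seq; apply: memv_suml => g /inG[_]; exact.
have G_gt0 : (0 < #|` G|)%N.
  rewrite cardfs_gt0; apply/fset0Pn; exists \1%VF; apply/inG; split=> // u.
  by rewrite id_lfunE subrr mem0v.
rewrite w0 sub0r memvN => /(memvZ (#|` G|%:R^-1)).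
by rewrite scalerA mulVf ?scale1r // natf_neq0_pchar0.
Qed.

End FiniteLinearGroup.

(** * Linear forms and their kernels *)

Section LinearForms.
Variables (F : fieldType) (V : vectType F).
Implicit Types a b : 'Hom(V, F^o).

Lemma formBZ a u k v : a (u - k *: v) = (a u : F) - k * (a v : F).
Proof. by rewrite linearB linearZ. Qed.

Lemma hyperplane_lker a : hyperplane (lker a) <-> exists v, a v != 0.
Proof.
rewrite /hyperplane -(limg_ker_dim a fullv) capfv; split.
  move=> dima; apply: contrapT => a0.
  have a_eq0 : a = 0.
    apply/lfunP => v; rewrite zero_lfunE; apply/eqP/negPn/negP => av.
    by apply: a0; exists v.
  move: dima; rewrite a_eq0 (_ : limg 0 = 0%VS) ?dimv0 ?addn0.
    by move/esym/n_Sn.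
  by apply/eqP; rewrite -lkerE; apply/subvP => v _; rewrite memv_ker zero_lfunE.
move=> [v av]; rewrite -addn1; congr addn; apply/esym/anti_leq.
rewrite (leq_trans (dimvS (subvf _))) ?dimvf //=.
rewrite lt0n dimv_eq0; apply/eqP => /eqP; rewrite -lkerE => /subvP/(_ v).
by rewrite memvf memv_ker (negPf av) => /(_ isT).
Qed.

Lemma lker_eq_proportional a b : lker a = lker b ->
  exists2 k : F, k != 0 & forall v, a v = k * (b v : F).
Proof.
move=> kab; have ab0 v : (a v == 0) = (b v == 0) by rewrite -!memv_ker kab.
have [[u bu]|b0] := pselect (exists u, b u != 0); last first.
  exists 1 => [|v]; first exact: oner_neq0.
  rewrite mul1r; have [bv|/eqP bv] := eqVneq (b v) 0.
    by rewrite bv; apply/eqP; rewrite ab0 bv.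
  by case: b0; exists v; apply/eqP.
exists ((a u : F) / (b u : F)); first by rewrite mulf_neq0 ?invr_eq0 ?ab0.
move=> v; have : b (v - ((b v : F) / (b u : F)) *: u) == 0.
  by rewrite linearB linearZ /= -[X in _ - X]/(_ * _) divfK // subrr.
rewrite -ab0 linearB linearZ subr_eq0 => /eqP ->.
by rewrite /= -[LHS]/(_ * _); field.
Qed.

End LinearForms.

(** * Reflections and coroots *)

Section Roots.
Variables (F : fieldType) (charF0 : [pchar F] =i pred0).
Variables (V : vectType F) (A : {fset {vspace V}}) (alpha : A -> 'Hom(V, F^o)).
Variable W : set 'End(V).
Hypotheses (ker_alpha : forall H : A, lker (alpha H) = val H).
Hypotheses (W_fin : finite_set W) (W_grp : GL_subgroup W).
Hypothesis A_W : forall H, H \in A <->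
  exists s, [/\ W s, reflection s & H = lker (s - \1%VF)].

(* A pair (H, c) stands for the reflection v - alpha_H(v) c. *)
Definition coroot (x : A * V) : Prop :=
  x.2 != 0 /\ exists2 s, W s & forall v, s v = v - alpha x.1 v *: x.2.

Lemma alpha_neq0 H : exists v, alpha H v != 0.
Proof.
apply/hyperplane_lker; rewrite ker_alpha.
by have /A_W[s [_ [_ +] ->]] := valP H.
Qed.

(** If [alpha_H(u) <> 0], the vector [v - (alpha_H(v) / alpha_H(u)) u] lies in [H], so [s] fixes it;
    solving for [s v] gives the coroot [(u - s u) / alpha_H(u)]. *)
Lemma coroot_exists H : exists c, coroot (H, c).
Proof.
have /A_W[s [Ws _ Hs]] := valP H; have [u au] := alpha_neq0 H.
have fixE v : (s v == v) = (alpha H v == 0).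
  rewrite -memv_ker ker_alpha Hs memv_ker.
  by rewrite add_lfunE opp_lfunE id_lfunE subr_eq0.
exists ((alpha H u : F)^-1 *: (u - s u)); split=> /=.
  by rewrite scaler_eq0 invr_eq0 (negPf au) subr_eq0 eq_sym fixE.
exists s => // v; have : s (v - ((alpha H v : F) / (alpha H u : F)) *: u)
    == v - ((alpha H v : F) / (alpha H u : F)) *: u.
  by rewrite fixE linearB linearZ /= -[X in _ - X]/(_ * _) divfK // subrr.
rewrite linearB linearZ /= subr_eq => /eqP ->.
by rewrite scalerA scalerBr opprB addrA addrAC.
Qed.

(** If the pairing vanished, [s] would be a nontrivial transvection, which a finite group in
    characteristic zero does not contain. *)
Lemma coroot_pairing_neq0 x : coroot x -> alpha x.1 x.2 != 0.
Proof.
move=> [c0 [s Ws sE]]; apply/eqP => ac0; have [u au] := alpha_neq0 x.1.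
have NE v : s v - v = - (alpha x.1 v *: x.2) by rewrite sE addrC addKr.
have sc : s x.2 = x.2 by rewrite sE ac0 scale0r subr0.
have sN v : s (s v - v) = s v - v by rewrite NE linearN linearZ /= sc.
have /(_ u)/eqP := finite_group_unipotent charF0 W_fin W_grp Ws sN.
by rewrite -subr_eq0 NE oppr_eq0 scaler_eq0 (negPf au) (negPf c0).
Qed.

(* If s and t are the reflections of x and y, the commutator of s and t is
   unipotent, so s and t commute. *)
Lemma coroot_sym x y : coroot x -> coroot y ->
  alpha y.1 x.2 = 0 -> alpha x.1 y.2 = 0.
Proof.
case: x y => [H c] [K d] [/= c0 [s Ws sE]] [/= d0 [t Wt tE]] bc.
have [_ _ WM WV] := W_grp.
(* The vanishing of [alpha_K(c)] kills the other cross term, so [s t] and [t s] differ only along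
   [c]. *)
have stE u : s (t u) = t (s u) + (alpha K u * alpha H d) *: c.
  rewrite [t (s u)]tE [s u]sE [s _]sE [t u]tE.
  rewrite !formBZ bc mulr0 subr0 scalerBl.
  by rewrite opprB addrA addrAC; congr (_ + _); rewrite addrAC.
pose ts := (t \o s)%VF; have Wts : W ts by exact: WM.
have tsI := finite_group_inj W_grp Wts.
have tsK v : ts (ts^-1%VF v) = v by apply: lker0_lfunVK; exact/lker0P.
have tsVK v : ts^-1%VF (ts v) = v by apply: lker0_lfunK; exact/lker0P.
pose w := ((s \o t) \o ts^-1)%VF.
have Ww : W w by apply: (WM); [exact: WM|exact: WV].
have wE v : w v = v + (alpha K (ts^-1%VF v) * alpha H d) *: c.
  by rewrite /w !comp_lfunE stE -[t (s _)]comp_lfunE tsK.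
(* The vector [c] is an eigenvector of [ts], with nonzero eigenvalue as [ts] is injective; so
   [alpha_K] vanishes at [ts^-1 c] and [w] fixes [c]. *)
have tsc : ts c = (1 - alpha H c) *: c.
  rewrite comp_lfunE sE linearB linearZ /= tE bc scale0r subr0.
  by rewrite scalerBl scale1r.
have ac1 : 1 - alpha H c != 0.
  apply: contra_neq c0 => ac1; apply: tsI.
  by rewrite tsc ac1 scale0r linear0.
have Kc : alpha K (ts^-1%VF c) = 0.
  have := congr1 (alpha K) (tsVK c); rewrite tsc !linearZ /= bc => /eqP.
  by rewrite mulf_eq0 (negPf ac1) => /eqP.
have wc : w c = c by rewrite wE Kc mul0r scale0r addr0.
have wN v : w (w v - v) = w v - v.
  by rewrite [w v]wE addrC addKr linearZ /= wc.
have [u bu] := alpha_neq0 K.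
have /(_ (ts u))/eqP := finite_group_unipotent charF0 W_fin W_grp Ww wN.
rewrite wE tsVK -subr_eq0 addrC addKr scaler_eq0 (negPf c0) orbF mulf_eq0.
by rewrite (negPf bu) => /eqP.
Qed.

(** The conjugate by [s] of the reflection of [x] has the form [alpha_x] composed with [s]. Its
    kernel is a member of [A], and [k] absorbs the arbitrary choice of a form for that member. *)
Lemma coroot_conj x s : coroot x -> W s -> exists z (k : F),
  [/\ coroot z, k != 0 & forall v, alpha x.1 (s v) = k * alpha z.1 v].
Proof.
move=> [c0 [t Wt tE]] Ws; have [_ _ WM WV] := W_grp.
have sI := finite_group_inj W_grp Ws.
have sK v : s (s^-1%VF v) = v by apply: lker0_lfunVK; exact/lker0P.
have sVK v : s^-1%VF (s v) = v by apply: lker0_lfunK; exact/lker0P.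
pose a := (alpha x.1 \o s)%VF; pose c := s^-1%VF x.2.
have c_neq0 : c != 0.
  by apply: contra_neq c0 => c0; rewrite -[x.2]sK -/c c0 linear0.
pose t' := (s^-1 \o (t \o s))%VF.
have Wt' : W t' by apply: (WM); [exact: WV|exact: WM].
have t'E v : t' v = v - a v *: c.
  by rewrite !comp_lfunE tE linearB /= sVK linearZ.
have ker_a : lker a = lker (t' - \1%VF).
  apply/vspaceP => v; rewrite !memv_ker add_lfunE opp_lfunE id_lfunE t'E.
  by rewrite [_ - _]addrC addKr oppr_eq0 scaler_eq0 (negPf c_neq0) orbF.
have H'A : lker a \in A.
  apply/A_W; exists t'; split => //; split.
    by have [n] := finite_group_order W_fin W_grp Wt'; exists n.
  rewrite -ker_a; apply/hyperplane_lker; have [u au] := alpha_neq0 x.1.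
  by exists (s^-1%VF u); rewrite comp_lfunE sK.
have [|k k0 ak] := @lker_eq_proportional _ _ a (alpha [` H'A]).
  by rewrite ker_alpha.
exists ([` H'A], k *: c), k; split => //.
  split; first by rewrite scaler_eq0 negb_or k0.
  by exists t' => //= v; rewrite t'E ak scalerA mulrC.
by move=> v; rewrite -ak comp_lfunE.
Qed.

End Roots.

(** * Combinations of squares of linear forms *)

Lemma scalar_sum (F : fieldType) (V : vectType F) (I : finType)
    (f : V -> F^o) (k : I -> F) (w : I -> V) :
  scalar f -> f (\sum_i k i *: w i) = \sum_i k i * (f (w i) : F).
Proof.
move=> fl; have f0 : f 0 = 0.
  by have := fl (-1) 0 0; rewrite scaler0 addr0 => ->; rewrite mulN1r addNr.
elim: (index_enum I) => [|i s IH]; first by rewrite !big_nil.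
by rewrite !big_cons fl IH.
Qed.

Section SquareSpan.
Variables (F : fieldType) (V : vectType F) (I : finType).
Variable alpha : I -> 'Hom(V, F^o).

(** Membership in the image of [Phi], phrased on plain functions so that products of forms need no
    packaging as [quadform]. *)
Definition square_span (f : V -> F) : Prop :=
  exists m : I -> F, forall v, f v = \sum_i m i * (alpha i v : F) ^+ 2.

Lemma square_span_lin (k : F) f g h : square_span f -> square_span g ->
  (forall v, h v = k * f v + g v) -> square_span h.
Proof.
move=> [m mE] [m' m'E] hE; exists (fun i => k * m i + m' i) => v.
rewrite hE mE m'E mulr_sumr -big_split; apply: eq_bigr => i _ /=.
by rewrite mulrA mulrDl.
Qed.

Lemma square_span0 : square_span (fun=> 0).
Proof. by exists (fun=> 0) => v; rewrite big1 // => i _; rewrite mul0r. Qed.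

Lemma square_span_sq i : square_span (fun v => (alpha i v : F) ^+ 2).
Proof.
exists (fun j => (j == i)%:R) => v; rewrite (bigD1 i) //= eqxx mul1r.
by rewrite big1 ?addr0 // => j /negPf ->; rewrite mul0r.
Qed.

Lemma square_span_sum (J : finType) (m : J -> F) (f : J -> V -> F) h :
  (forall j, square_span (f j)) -> (forall v, h v = \sum_j m j * f j v) ->
  square_span h.
Proof.
move=> fS hE; have : square_span (fun v => \sum_j m j * f j v).
  elim: (index_enum J) => [|j s IH].
    by have [n nE] := square_span0; exists n => v; rewrite big_nil -nE.
  by apply: (square_span_lin (k := m j) (fS j) IH) => v; rewrite big_cons.
by case=> n nE; exists n => v; rewrite hE nE.
Qed.

Definition eval_forms (v : V) : {ffun I -> F^o} := [ffun i => alpha i v].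

Fact eval_forms_is_linear : linear eval_forms.
Proof. by move=> k u v; apply/ffunP => i; rewrite !ffunE linearP. Qed.

HB.instance Definition _ := GRing.isLinear.Build F V {ffun I -> F^o} *:%R
  eval_forms eval_forms_is_linear.

(** Evaluation at all the forms embeds [V] into the functions on [I]; the [w i] are the images of
    the standard basis under a left inverse. *)
Lemma separating_forms_dual : (forall v, (forall i, alpha i v = 0) -> v = 0) ->
  exists w : I -> V, forall v, v = \sum_i alpha i v *: w i.
Proof.
move=> sep; pose T := linfun eval_forms.
have T0 : lker T == 0%VS.
  rewrite -subv0; apply/subvP => v; rewrite memv_ker lfunE => /eqP/ffunP Tv.
  by rewrite memv0; apply/eqP/sep => i; have := Tv i; rewrite !ffunE.
exists (fun i => T^-1%VF [ffun j => (j == i)%:R]) => v.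
rewrite -[LHS](lker0_lfunK T0).
transitivity (T^-1%VF (\sum_i alpha i v *: [ffun j => (j == i)%:R])).
  congr (_ _); apply/ffunP => j; rewrite lfunE !ffunE sum_ffunE (bigD1 j) //=.
  rewrite !ffunE eqxx big1 => [|i /negPf ji]; last first.
    by rewrite !ffunE eq_sym ji [LHS]mulr0.
  by rewrite addr0 [RHS]mulr1.
by rewrite linear_sum; apply: eq_bigr => i _; rewrite linearZ.
Qed.

(** Since [2 q(v) = polar q v v], substituting [v = sum_i alpha_i(v) w_i] in both arguments writes
    [q] as a combination of the products [alpha_i alpha_j]. *)
Lemma square_span_quadform :
    2 != 0 :> F -> (forall v, (forall i, alpha i v = 0) -> v = 0) ->
    (forall i j, square_span (fun v => (alpha i v : F) * (alpha j v : F))) ->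
  forall q : quadform V, square_span q.
Proof.
move=> nz2 /separating_forms_dual[w wE] prodS q.
have /asboolP[qZ ql qr] := quadformP q.
have q2 v : polar q v v = 2 * (q v : F).
  rewrite /polar -mulr2n -scaler_nat qZ -[LHS]/((_ : F) - _ - _); ring.
pose b i j : F := 2^-1 * polar q (w i) (w j).
have wq i v : polar q (w i) v
    = \sum_j (alpha j v : F) * (polar q (w i) (w j) : F).
  by rewrite {1}[v]wE (scalar_sum _ _ (qr _)).
have qE v : q v = \sum_i 1 * \sum_j (2^-1 * (polar q (w i) (w j) : F)) *
    ((alpha i v : F) * (alpha j v : F)).
  have -> : q v = 2^-1 * (polar q v v : F) by rewrite q2 mulKf.
  rewrite {1}[v]wE (scalar_sum _ _ (ql v)) mulr_sumr.
  apply: eq_bigr => i _; rewrite mul1r wq.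
  by rewrite !mulr_sumr; apply: eq_bigr => j _; ring.
by apply: square_span_sum qE => i; apply: square_span_sum (prodS i) _.
Qed.

End SquareSpan.

(** * Chains of adjacent reflections *)

Section Chains.
Variables (F : fieldType) (charF0 : [pchar F] =i pred0).
Variables (V : vectType F) (A : {fset {vspace V}}) (alpha : A -> 'Hom(V, F^o)).
Variable W : set 'End(V).
Hypotheses (ker_alpha : forall H : A, lker (alpha H) = val H).
Hypotheses (W_fin : finite_set W) (W_grp : GL_subgroup W).
Hypothesis A_W : forall H, H \in A <->
  exists s, [/\ W s, reflection s & H = lker (s - \1%VF)].

Local Notation coroot := (coroot alpha W).

Fixpoint chain n (x y : A * V) : Prop :=
  if n is m.+1 then
    exists z, [/\ coroot z, alpha z.1 x.2 != 0 & chain m z y]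
  else x = y.

Lemma adjacent_square_span x y : coroot x -> coroot y -> alpha y.1 x.2 != 0 ->
  square_span alpha (fun v => (alpha x.1 v : F) * (alpha y.1 v : F)).
Proof.
move=> rx ry axy; have [_ [s Ws sE]] := rx.
have [z [k [_ _ zE]]] := coroot_conj ker_alpha W_fin W_grp A_W ry Ws.
set c : F := alpha y.1 x.2 in axy.
have nz2 := natf_neq0_pchar0 charF0 (ltn0Sn 1).
have E v : k * (alpha z.1 v : F) = (alpha y.1 v : F) - (alpha x.1 v : F) * c.
  by rewrite -zE sE formBZ.
pose sq := square_span_sq alpha.
have S1 : square_span alpha (fun v => - k ^+ 2 * (alpha z.1 v : F) ^+ 2
    + (alpha y.1 v : F) ^+ 2).
  exact: square_span_lin (sq z.1) (sq y.1) _.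
have S2 : square_span alpha (fun v => c ^+ 2 * (alpha x.1 v : F) ^+ 2
    + (- k ^+ 2 * (alpha z.1 v : F) ^+ 2 + (alpha y.1 v : F) ^+ 2)).
  exact: square_span_lin (sq x.1) S1 _.
(* From [k alpha_z = alpha_y - c alpha_x], the combination [c^2 alpha_x^2 - k^2 alpha_z^2 +
   alpha_y^2] equals [2 c alpha_x alpha_y]. *)
apply: (square_span_lin (k := (2 * c)^-1) S2 (square_span0 alpha)) => v.
rewrite mulNr -[k ^+ 2 * _]exprMn E; field.
by apply/andP; split.
Qed.

(* Conjugating x by the reflection of its neighbour z1 makes it adjacent to the
   next vertex z2, which shortens the chain. *)
Lemma chain_square_span n x y : coroot x -> coroot y -> chain n x y ->
  square_span alpha (fun v => (alpha x.1 v : F) * (alpha y.1 v : F)).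
Proof.
have sym u v := @coroot_sym _ charF0 _ _ _ _ ker_alpha W_fin W_grp A_W u v.
elim/ltn_ind: n x y => -[|[|n]] IH x y rx ry.
- by move=> /= <-; apply: square_span_sq.
- by move=> /= [z [rz xz <-]]; exact: adjacent_square_span.
move=> /= [z1 [r1 x1 [z2 [r2 z12 ch]]]].
(* If [x] is adjacent to [z2], dropping [z1] already shortens the chain. *)
have [x2|x2] := eqVneq (alpha z2.1 x.2) 0; last first.
  by apply: (IH n.+1) => //=; exists z2.
have [_ [s Ws sE]] := r1.
have [x' [k [rx' _ x'E]]] := coroot_conj ker_alpha W_fin W_grp A_W rx Ws.
have S1 := IH n.+1 (ltnSn _) z1 y r1 ry (ex_intro _ z2 (And3 r2 z12 ch)).
(* At the coroot of [z2], [alpha_x] composed with [s] equals [- alpha_z1(c_z2) alpha_x(c_z1)],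
   nonzero by adjacency and symmetry, so [alpha_x'] cannot vanish there. *)
have x'2 : alpha z2.1 x'.2 != 0.
  apply/eqP => /(sym _ _ rx' r2) a0.
  have := x'E z2.2; rewrite a0 mulr0 sE formBZ (sym _ _ rx r2 x2) sub0r => /eqP.
  rewrite oppr_eq0 mulf_eq0 => /orP[]/eqP.
    by move=> /(sym _ _ r2 r1)/eqP; rewrite (negPf z12).
  by move=> /(sym _ _ r1 rx)/eqP; rewrite (negPf x1).
have S' := IH n.+1 (ltnSn _) x' y rx' ry (ex_intro _ z2 (And3 r2 x'2 ch)).
have S2 := square_span_lin (k := k) S' (square_span0 alpha) (fun=> erefl).
(* Here [alpha_x = alpha_x(c_z1) alpha_z1 + k alpha_x'], and the products of [alpha_z1] and
   [alpha_x'] with [alpha_y] come from shorter chains. *)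
apply: (square_span_lin (k := alpha x.1 z1.2) S1 S2) => v.
rewrite addr0 mulrA -x'E sE formBZ; ring.
Qed.

End Chains.

(** * Splitting an arrangement along a partition *)

Lemma memv_img_can (F : fieldType) (V V' : vectType F) (f : 'Hom(V, V')) g
    (U : {vspace V}) p :
  cancel f g -> cancel g f -> (p \in (f @: U)%VS) = (g p \in U).
Proof.
move=> fK gK; apply/memv_imgP/idP => [[u Uu ->]|Ugp]; first by rewrite fK.
by exists (g p).
Qed.

Lemma essential_eq0 (F : fieldType) (V : vectType F) (A : {fset {vspace V}}) v :
  essential A -> (forall H, H \in A -> v \in H) -> v = 0.
Proof.
move=> Aess vA; apply/eqP; rewrite -memv0 -Aess big_seq.
by elim/big_rec: _ => [|H U /vA vH vU]; rewrite ?memvf // memv_cap vH.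
Qed.

Section Decomposition.
Variables (F : fieldType) (V : vectType F) (A : {fset {vspace V}}).
Variables (alpha : A -> 'Hom(V, F^o)).
Hypothesis ker_alpha : forall H : A, lker (alpha H) = val H.
Variable B : pred A.

Let V1 := (\bigcap_(H | ~~ B H) val H)%VS.
Let V2 := (\bigcap_(H | B H) val H)%VS.

Lemma mem_bigcap_alpha (P : pred A) v :
  reflect (forall H, P H -> alpha H v = 0)
    (v \in (\bigcap_(H | P H) val H)%VS).
Proof.
rewrite memvE; apply: (iffP subv_bigcapP) => h H /h.
  by rewrite -memvE -ker_alpha memv_ker => /eqP.
by rewrite -memvE -ker_alpha memv_ker => /eqP.
Qed.

(* The addition map is an isomorphism from V1 + V2 to V, whose inverse takes A
   to the product of B restricted to V1 and of its complement restricted to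
   V2. *)
Lemma separated_arrangement_reducible :
    essential A -> (V1 + V2 = fullv)%VS ->
    (forall H, B H -> exists2 c, c \in V1 & alpha H c != 0) ->
    (forall H, ~~ B H -> exists2 c, c \in V2 & alpha H c != 0) ->
    (exists H, B H) -> (exists H, ~~ B H) ->
  ~ irreducible_arr A.
Proof.
move=> Aess V12 c1 c2 [H1 BH1] [H2 BH2] Airr; apply: Airr.
pose j1 : 'Hom(subvs_of V1, V) := linfun vsval.
pose j2 : 'Hom(subvs_of V2, V) := linfun vsval.
pose res1 (H : A) := (j1 @^-1: val H)%VS.
pose res2 (H : A) := (j2 @^-1: val H)%VS.
exists (subvs_of V1), (subvs_of V2).
exists [fset res1 H | H in B], [fset res2 H | H in [pred H | ~~ B H]].
have dim_gt0 (U : {vspace V}) (H : A) :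
    (exists2 c, c \in U & alpha H c != 0) -> (0 < \dim {:subvs_of U})%N.
  move=> [c cU ac]; rewrite dimvf /= /dim /= lt0n dimv_eq0.
  apply: contraNneq ac => U0.
  by move: cU; rewrite U0 memv0 => /eqP ->; rewrite linear0.
have hyp (U : {vspace V}) (H : A) : (exists2 c, c \in U & alpha H c != 0) ->
    hyperplane (linfun (vsval : subvs_of U -> V) @^-1: val H)%VS.
  move=> [c cU ac].
  have -> : (linfun (vsval : subvs_of U -> V) @^-1: val H)%VS =
      lker (alpha H \o linfun (vsval : subvs_of U -> V))%VF.
    apply/vspaceP => u.
    by rewrite -memv_preim memv_ker comp_lfunE -ker_alpha memv_ker.
  apply/hyperplane_lker; exists (vsproj U c).
  by rewrite comp_lfunE lfunE /= vsprojK.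
split.
- by split; [apply: (dim_gt0 _ _ (c1 _ BH1))|apply: (dim_gt0 _ _ (c2 _ BH2))].
- by split=> _ /imfsetP[H /= BH ->]; apply: hyp; [apply: c1|apply: c2].
pose p1 : 'Hom((subvs_of V1 * subvs_of V2)%type, subvs_of V1) := linfun fst.
pose p2 : 'Hom((subvs_of V1 * subvs_of V2)%type, subvs_of V2) := linfun snd.
pose g := ((j1 \o p1) + (j2 \o p2))%VF.
have gE p : g p = vsval p.1 + vsval p.2.
  by rewrite add_lfunE !comp_lfunE !lfunE.
(* If [u1 + u2 = 0], then [u1] lies in both [V1] and [V2], hence in every hyperplane, and is 0 by
   essentiality. *)
have gker : lker g == 0%VS.
  rewrite -subv0; apply/subvP => -[u1 u2].
  rewrite memv_ker gE memv0 /= => /eqP e.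
  have u1E : vsval u1 = - vsval u2 by apply/eqP; rewrite -addr_eq0 e.
  have z1 : vsval u1 = 0.
    apply: (essential_eq0 Aess) => H HA.
    rewrite -[H]/(val [` HA]) -ker_alpha.
    have [BH|BH] := boolP (B [` HA]).
      have /mem_bigcap_alpha/(_ _ BH) := subvsP u2.
      by rewrite u1E memvN memv_ker => ->.
    by have /mem_bigcap_alpha/(_ _ BH) := subvsP u1; rewrite memv_ker => ->.
  have z2 : vsval u2 = 0 by move: e; rewrite z1 add0r.
  by apply/eqP; congr (_, _); apply: subvs_inj; rewrite linear0.
have gsurj v : exists p, g p = v.
  have := memvf v; rewrite -V12 => /memv_addP[v1 Vv1 [v2 Vv2 ->]].
  by exists (vsproj V1 v1, vsproj V2 v2); rewrite gE /= !vsprojK.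
have gK : cancel g g^-1%VF := lker0_lfunK gker.
have gVK : cancel g^-1%VF g by move=> v; have [p <-] := gsurj v; rewrite gK.
exists g^-1%VF; split; first by exists g.
(* For [H] in [B], [alpha_H] vanishes on [V2], so [u1 + u2] lies in [H] exactly when [u1] does. *)
have im1 H : B H -> (g^-1 @: val H)%VS = dsumv (res1 H) fullv.
  move=> BH; apply/vspaceP => p; rewrite (memv_img_can _ _ gVK gK) gE.
  rewrite mem_dsumv memvf andbT -memv_preim lfunE -ker_alpha !memv_ker.
  have /mem_bigcap_alpha/(_ _ BH) := subvsP p.2.
  by rewrite linearD /= => ->; rewrite addr0.
have im2 H : ~~ B H -> (g^-1 @: val H)%VS = dsumv fullv (res2 H).
  move=> BH; apply/vspaceP => p; rewrite (memv_img_can _ _ gVK gK) gE.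
  rewrite mem_dsumv memvf -memv_preim lfunE -ker_alpha !memv_ker.
  have /mem_bigcap_alpha/(_ _ BH) := subvsP p.1.
  by rewrite linearD /= => ->; rewrite add0r.
apply/fsetP => U; rewrite in_fsetU; apply/orP/imfsetP.
  move=> [] /imfsetP[_ /imfsetP[H /= BH ->] ->]; exists (val H).
  - exact: valP.
  - by rewrite im1.
  - exact: valP.
  - by rewrite im2.
move=> [K /= KA ->]; have [BK|BK] := boolP (B [` KA]).
  left; rewrite -[K]/(val [` KA]) im1 //.
  by apply/imfsetP; exists (res1 [` KA]) => //; apply/imfsetP; exists [` KA].
right; rewrite -[K]/(val [` KA]) im2 //.
by apply/imfsetP; exists (res2 [` KA]) => //; apply/imfsetP; exists [` KA].
Qed.

End Decomposition.


(** * Squares of forms on a product arrangement *)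

Lemma exists_form_eq1 (F : fieldType) (V : vectType F) :
  (0 < \dim {:V})%N -> exists (a : 'Hom(V, F^o)) v, a v = 1.
Proof.
move=> V0; pose i := Ordinal V0; pose e := vbasis {:V}.
exists (linfun (coord e i : V -> F^o)), e`_i.
have := coord_free (X := e) i i (basis_free (vbasisP _)).
by rewrite eqxx lfunE.
Qed.

(** Adding one coordinate form from each factor gives a form whose square has a nonzero mixed
    term. *)
Lemma exists_form_eq1_prod (F : fieldType) (V V1 V2 : vectType F)
    (f : 'Hom(V, (V1 * V2)%type)) (g : V1 * V2 -> V) :
  cancel g f -> (0 < \dim {:V1})%N -> (0 < \dim {:V2})%N ->
  exists (b : 'Hom(V, F^o)) v1 v2, b (g (v1, 0)) = 1 /\ b (g (0, v2)) = 1.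
Proof.
move=> gK /exists_form_eq1[a1 [v1 a1v]] /exists_form_eq1[a2 [v2 a2v]].
pose p1 : 'Hom((V1 * V2)%type, V1) := linfun fst.
pose p2 : 'Hom((V1 * V2)%type, V2) := linfun snd.
pose b := ((a1 \o p1) + (a2 \o p2))%VF.
exists (b \o f)%VF, v1, v2.
rewrite !comp_lfunE !gK !add_lfunE !comp_lfunE !lfunE /=.
by rewrite !linear0 a1v a2v addr0 add0r.
Qed.

Section Reducible.
Variables (F : fieldType) (V : vectType F) (A : {fset {vspace V}}).
Variables (alpha : A -> 'Hom(V, F^o)).
Hypothesis ker_alpha : forall H : A, lker (alpha H) = val H.

(** On a product, each [alpha_H] vanishes on one factor, so its square is additive on two vectors
    taken from the two factors; a form equal to 1 on both has square 4 at their sum, not 1 + 1. *)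
Lemma reducible_square_span :
  2 != 0 :> F -> (forall b : 'Hom(V, F^o), square_span alpha (sqform b)) ->
  irreducible_arr A.
Proof.
move=> nz2 sqS [V1 [V2 [A1 [A2 [[V1_gt0 V2_gt0] [A1arr A2arr] [f [fb AE]]]]]]].
have [g fK gK] := fb.
have [b [v1 [v2 [bv1 bv2]]]] := exists_form_eq1_prod gK V1_gt0 V2_gt0.
have a0 (H : A) : (alpha H (g (v1, 0)) : F) * (alpha H (g (0, v2)) : F) = 0.
  have : (f @: val H)%VS \in arr_prod A1 A2.
    by rewrite AE; apply/imfsetP; exists (val H) => //=; exact: valP.
  have memH p : (p \in (f @: val H)%VS) = (alpha H (g p) == 0).
    by rewrite (memv_img_can _ _ fK gK) -ker_alpha memv_ker.
  rewrite in_fsetU => /orP[] /imfsetP[K /= _ fHE].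
    have := memH (0, v2); rewrite fHE mem_dsumv mem0v memvf => /esym/eqP ->.
    exact: mulr0.
  have := memH (v1, 0); rewrite fHE mem_dsumv mem0v memvf => /esym/eqP ->.
  exact: mul0r.
have polarE (a : 'Hom(V, F^o)) : (a (g (v1, 0) + g (0, v2)) : F) ^+ 2
    = (a (g (v1, 0)) : F) ^+ 2 + (a (g (0, v2)) : F) ^+ 2
      + 2 * ((a (g (v1, 0)) : F) * (a (g (0, v2)) : F)).
  have sqD (x y : F) : (x + y) ^+ 2 = x ^+ 2 + y ^+ 2 + 2 * (x * y) by ring.
  by rewrite linearD; exact: sqD.
have [m mE] := sqS b.
have := mE (g (v1, 0) + g (0, v2)).
under eq_bigr => H _ do rewrite polarE a0 mulr0 addr0 mulrDr.
rewrite big_split /= -!mE /= polarE bv1 bv2 mulr1 => /eqP.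
by rewrite -subr_eq0 addrC addKr mulr1 (negPf nz2).
Qed.

End Reducible.

(** * Irreducible reflection arrangements *)

Section Irreducible.
Variables (F : fieldType) (charF0 : [pchar F] =i pred0).
Variables (V : vectType F) (A : {fset {vspace V}}) (alpha : A -> 'Hom(V, F^o)).
Hypotheses (A_ess : essential A) (A_refl : reflection_arrangement A).
Hypothesis ker_alpha : forall H : A, lker (alpha H) = val H.

(** Finite order makes the generators injective, as [smallest_GL_subgroup] requires. *)
Lemma finite_reflection_group_GL (W : set 'End(V)) :
  finite_reflection_group W -> finite_set W /\ GL_subgroup W.
Proof.
move=> [Wfin [S Srefl WE]]; split=> //; rewrite WE.
apply: smallest_GL_subgroup => s /Srefl[[n n_gt0 sn] _].
apply/eqP/lker0P => u v suv; rewrite -[u]sn -[v]sn.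
by rewrite -(prednK n_gt0) !iterSr suv.
Qed.

Lemma irreducible_square_span : irreducible_arr A ->
  forall q : quadform V, square_span alpha q.
Proof.
move=> A_irr; have [W /finite_reflection_group_GL[Wfin Wgrp] A_W] := A_refl.
have alpha_sep v : (forall H, alpha H v = 0) -> v = 0.
  move=> av; apply: (essential_eq0 A_ess) => H HA.
  by rewrite -[H]/(val [` HA]) -ker_alpha memv_ker av.
apply: square_span_quadform (alpha_sep) _.
  exact: natf_neq0_pchar0 (ltn0Sn 1).
move=> H0 K0.
have [d0 rK0] := coroot_exists ker_alpha A_W K0.
(* The hyperplanes of the component of [K0]. If [H0] is not among them, [B] and its complement are
   nonempty and split [A], against irreducibility. *)
pose B (H : A) := `[< exists c, coroot alpha W (H, c) /\
  exists n, chain alpha W n (H, c) (K0, d0) >].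
have [/asboolP[c [rc [n ch]]]|BH0] := boolP (B H0).
  exact: (chain_square_span charF0 ker_alpha Wfin Wgrp A_W rc rK0 ch).
(* Adjacency of [(K, d)] to a reflection of [H] reads only [alpha_H(d)], so the coroot [c'] on the
   chain may differ from [c]. *)
have sep x y : coroot alpha W x -> coroot alpha W y -> B x.1 -> ~~ B y.1 ->
    alpha x.1 y.2 = 0.
  case: x y => [H c] [K d] rx ry /asboolP[c' [rc' [n ch]]] BK.
  apply/eqP; apply: contraNT BK => aHd; apply/asboolP.
  by exists d; split=> //; exists n.+1, (H, c').
have sepV1 x : coroot alpha W x -> B x.1 ->
    x.2 \in (\bigcap_(H | ~~ B H) val H)%VS.
  move=> rx Bx; apply/(mem_bigcap_alpha ker_alpha) => H BH.
  have [c rc] := coroot_exists ker_alpha A_W H.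
  have := sep _ _ rx rc Bx BH.
  exact: (coroot_sym charF0 ker_alpha Wfin Wgrp A_W rc rx).
have sepV2 x : coroot alpha W x -> ~~ B x.1 ->
    x.2 \in (\bigcap_(H | B H) val H)%VS.
  move=> rx Bx; apply/(mem_bigcap_alpha ker_alpha) => H BH.
  have [c rc] := coroot_exists ker_alpha A_W H.
  exact: (sep _ _ rc rx BH Bx).
case: (separated_arrangement_reducible ker_alpha (B := B) A_ess) => //.
(* The reflections of [W] move vectors along coroots, each lying in one of the two intersections,
   and a vector that they all fix lies in every hyperplane. *)
- apply: (finite_group_coinvariants charF0 Wfin Wgrp (T := [set s | W s /\
    exists2 x, coroot alpha W x & forall v, s v = v - alpha x.1 v *: x.2])).
  + by move=> s [].
  + move=> s v [_ [x rx sE]]; rewrite sE addrC addKr memvN memvZ //.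
    have [Bx|Bx] := boolP (B x.1).
      by rewrite -[x.2]addr0 memv_add ?mem0v // sepV1.
    by rewrite -[x.2]add0r memv_add ?mem0v // sepV2.
  + move=> w Tw; apply: alpha_sep => H.
    have [c rc] := coroot_exists ker_alpha A_W H.
    have [/= c0 [s Ws sE]] := rc.
    have : s w = w by apply: Tw; split=> //; exists (H, c).
    move=> /eqP; rewrite sE -subr_eq0 addrC addKr oppr_eq0 scaler_eq0.
    by rewrite (negPf c0) orbF => /eqP.
- move=> H BH; have [c rc] := coroot_exists ker_alpha A_W H.
  exists c; first exact: (sepV1 _ rc BH).
  exact: (coroot_pairing_neq0 charF0 ker_alpha Wfin Wgrp A_W rc).
- move=> H BH; have [c rc] := coroot_exists ker_alpha A_W H.
  exists c; first exact: (sepV2 _ rc BH).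
  exact: (coroot_pairing_neq0 charF0 ker_alpha Wfin Wgrp A_W rc).
- by exists K0; apply/asboolP; exists d0; split=> //; exists 0%N.
- by exists H0.
Qed.

End Irreducible.

(** * The map [Phi] and its image *)

Lemma ffun_sum_basis (F : fieldType) (I : finType) (x : {ffun I -> F^o}) :
  x = \sum_i x i *: [ffun j => (j == i)%:R : F^o].
Proof.
apply/ffunP => j; rewrite sum_ffunE (bigD1 j) //= !ffunE eqxx.
rewrite big1 => [|i /negPf ij]; first by rewrite addr0 [RHS]mulr1.
by rewrite !ffunE eq_sym ij [LHS]mulr0.
Qed.

Lemma quadform_sumE (F : fieldType) (V : vectType F) (I : finType)
    (k : I -> F) (p : I -> quadform V) v :
  (\sum_i k i *: p i) v = \sum_i k i * (p i v : F).
Proof.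
elim: (index_enum I) => [|i s IH]; first by rewrite !big_nil.
by rewrite !big_cons -IH.
Qed.

Lemma squares_surjective_iff_irreducible (F : fieldType) (V : vectType F)
    (A : {fset {vspace V}}) (alpha : A -> 'Hom(V, F^o))
    (Phi : {linear {ffun A -> F^o} -> quadform V}) :
    [pchar F] =i pred0 -> essential A -> reflection_arrangement A ->
    (forall H : A, lker (alpha H) = val H) ->
    (forall H : A, Phi (basis_vec H) = sqform (alpha H)) ->
  (forall q : quadform V, exists x, Phi x = q) <-> irreducible_arr A.
Proof.
move=> charF0 A_ess A_refl ker_alpha PhiE.
(* The image of [Phi] thus consists of the quadratic forms satisfying [square_span alpha]. *)
have PhixE (x : {ffun A -> F^o}) v :
    Phi x v = \sum_H (x H : F) * (alpha H v : F) ^+ 2.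
  rewrite {1}[x]ffun_sum_basis.
  transitivity ((\sum_H (x H : F) *: sqform (alpha H)) v).
    rewrite linear_sum; congr (quadform_fun _ v).
    by apply: eq_bigr => H _; rewrite linearZ -PhiE.
  exact: quadform_sumE.
split=> [Phi_surj|A_irr q].
  apply: (reducible_square_span ker_alpha).
    exact: natf_neq0_pchar0 (ltn0Sn 1).
  move=> b; have [x xE] := Phi_surj (sqform b).
  by exists x => v; rewrite -xE PhixE.
have [m mE] := irreducible_square_span charF0 A_ess A_refl ker_alpha A_irr q.
exists [ffun H => m H : F^o]; apply/val_inj/funext => v.
by rewrite [LHS]PhixE [RHS]mE; apply: eq_bigr => H _; rewrite ffunE.
Qed.

Theorem theorem4p2 (R : realType) (V : vectType R[i]) (A : {fset {vspace V}})
    (alpha : A -> 'Hom(V, R[i]^o))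
    (Phi : {linear {ffun A -> R[i]^o} -> quadform V})
    (V_neq0 : (0 < \dim {:V})%N)
    (A_ess : essential A)
    (A_refl : reflection_arrangement A)
    (ker_alpha : forall H : A, lker (alpha H) = val H)
    (PhiE : forall H : A, Phi (basis_vec H) = sqform (alpha H)) :
  (forall q : quadform V, exists x, Phi x = q) <-> irreducible_arr A.
Proof.
have charF0 : [pchar R[i]] =i pred0 by exact: Num.Theory.pchar_num.
exact (squares_surjective_iff_irreducible
  charF0 A_ess A_refl ker_alpha PhiE).
Qed.
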